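(* Let $\mathcal{M}$ be a Riemannian manifold and let $\mathcal{T}_{\boldsymbol{\alpha}}$ be a non-interpolating subdivision scheme over $\mathcal{M}$ (the Riemannian center-of-mass analogue of the linear scheme with finitely supported shift invariant mask $\boldsymbol{\alpha}$). Let $\varepsilon>0$ be any truncation parameter, let $\boldsymbol{\zeta}$ be the normalized truncated decimation mask determined by $\boldsymbol{\alpha}$ and $\varepsilon$, and let $\mathcal{Y}_{\boldsymbol{\zeta}}$ be the corresponding decimation operator over $\mathcal{M}$. Then the pair $(\mathcal{T}_{\boldsymbol{\alpha}},\mathcal{Y}_{\boldsymbol{\zeta}})$ is safe; that is, $\mathcal{T}_{\boldsymbol{\alpha}}$ is displacement-safe and $\mathcal{Y}_{\boldsymbol{\zeta}}$ is decimation-safe: there exist constants $E_{\mathcal{T}}\ge 0$ and $F_{\mathcal{Y}}\ge 0$ such that for every admissible $\mathcal{M}$-valued sequence $\boldsymbol{c}$, $$\mu\big(\boldsymbol{c},\mathcal{T}_{\boldsymbol{\alpha}}(\boldsymbol{c})\downarrow 2\big)\le E_{\mathcal{T}}\,\Delta_{\mathcal{M}}(\boldsymbol{c})\qquad\text{and}\qquad \mu\big(\mathcal{Y}_{\boldsymbol{\zeta}}\boldsymbol{c},\boldsymbol{c}\downarrow 2\big)\le F_{\mathcal{Y}}\,\Delta_{\mathcal{M}}(\boldsymbol{c}).$$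
   Context: All sequences are bi-infinite, indexed by $\mathbb{Z}$. $\mathcal{M}$ is a Riemannian manifold with geodesic distance $\rho$. For $\mathcal{M}$-valued sequences, $(\boldsymbol{c}\downarrow 2)_k=c_{2k}$, $\Delta_{\mathcal{M}}(\boldsymbol{c})=\sup_{k\in\mathbb{Z}}\rho(c_{k+1},c_k)$ and $\mu(\boldsymbol{c},\boldsymbol{m})=\sup_{k\in\mathbb{Z}}\rho(c_k,m_k)$. Masks. $\boldsymbol{\alpha}$ is a finitely supported real sequence with $\sum_i\alpha_{2i}=\sum_i\alpha_{2i+1}=1$ (shift invariance), the mask of a convergent linear subdivision scheme. $\boldsymbol{\gamma}$ is a real sequence solving the convolution equation $\boldsymbol{\gamma}\ast(\boldsymbol{\alpha}\downarrow 2)=\boldsymbol{\delta}$ ($\boldsymbol\delta$ the Kronecker delta sequence); it satisfies $\sum_i\gamma_i=1$ and $|\gamma_k|\le C\lambda^{|k|}$ for some $C>0$, $0<\lambda<1$. For $\varepsilon>0$, the truncation is $\widetilde\gamma_k=\gamma_k$ if $|\gamma_k|>\varepsilon$ and $\widetilde\gamma_k=0$ otherwise; its (finite) support is $\Omega_\varepsilon$. The normalized mask is $\zeta_k=\widetilde\gamma_k/\sum_{i\in\Omega_\varepsilon}\widetilde\gamma_i$ (the denominator being nonzero), so $\sum_k\zeta_k=1$ (a decimation mask with sum 1 is also called shift invariant). Operators. $\mathcal{T}_{\boldsymbol{\alpha}}(\boldsymbol{c})_k=\arg\min_{x\in\mathcal{M}}\sum_i\alpha_{k-2i}\,\rho(x,c_i)^2$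 and $\mathcal{Y}_{\boldsymbol{\zeta}}(\boldsymbol{c})_k=\arg\min_{x\in\mathcal{M}}\sum_i\zeta_{k-i}\,\rho(x,c_{2i})^2$, $k\in\mathbb{Z}$. The scheme is interpolating if $\mathcal{T}_{\boldsymbol{\alpha}}(\boldsymbol{c})_{2k}=c_k$ for all $k$ and all $\boldsymbol c$, and non-interpolating otherwise. An $\mathcal{M}$-valued sequence is admissible if all these minimization problems (for shift invariant masks $\boldsymbol\alpha$, $\boldsymbol\zeta$) have a unique solution, so that $\mathcal{T}_{\boldsymbol\alpha}(\boldsymbol c)$ and $\mathcal{Y}_{\boldsymbol\zeta}(\boldsymbol c)$ are well defined. *)

(* Defs.v *)
From HB Require Import structures.
From mathcomp Require Import all_boot all_order all_algebra.
From mathcomp Require Import all_classical all_reals all_analysis.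

Set Implicit Arguments.
Unset Strict Implicit.
Unset Printing Implicit Defensive.

Import Order.TTheory GRing.Theory Num.Theory.
Import numFieldNormedType.Exports.

Local Open Scope classical_set_scope.
Local Open Scope ring_scope.

(* [f] is of class C^k on the open set [U]; the derivative of a C^(k+1) map is
   required to be C^k through each of its directional values [x |-> 'D_v f x],
   which in finite dimension is the same as asking it of [x |-> 'd f x]. *)
Fixpoint class_C (R : realType) (V W : normedModType R) (k : nat)
    (U : set V) (f : V -> W) : Prop :=
  match k with
  | 0%N => forall x, U x -> {for x, continuous f}
  | k'.+1 => (forall x, U x -> differentiable f x) /\
             (forall v : V, class_C k' U (fun x => 'D_v f x))
  end.

Definition smooth_on (R : realType) (V W : normedModType R)
    (U : set V) (f : V -> W) : Prop :=
  forall k : nat, class_C k U f.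

(* Charts are total functions of which only the restriction to [chart_dom i]
   is meaningful; [chart_inv i] is only meaningful on its image. *)
Record smoothManifold (R : realType) := SmoothManifold {
  manifold_sort :> topologicalType;
  dimension : nat;
  manifold_hausdorff : hausdorff_space manifold_sort;
  manifold_second_countable : @second_countable manifold_sort;
  chart_index : Type;
  chart_dom : chart_index -> set manifold_sort;
  chart : chart_index -> manifold_sort -> 'rV[R]_dimension;
  chart_inv : chart_index -> 'rV[R]_dimension -> manifold_sort;
  chart_at : manifold_sort -> chart_index;
  chart_atP : forall p, chart_dom (chart_at p) p;
  chart_dom_open : forall i, open (chart_dom i);
  chart_image_open : forall i, open (chart i @` chart_dom i);
  chartK : forall i p, chart_dom i p -> chart_inv i (chart i p) = p;
  chart_continuous : forall i p, chart_dom i p -> {for p, continuous (chart i)};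
  chart_inv_continuous : forall i p, chart_dom i p ->
    {for chart i p, continuous (chart_inv i)};
  transition_smooth : forall i j,
    smooth_on (chart i @` (chart_dom i `&` chart_dom j))
              (chart j \o chart_inv i)
}.

Definition inner_mx (R : realType) (n : nat) (G : 'M[R]_n) (v w : 'rV[R]_n) : R :=
  (v *m G *m w^T) 0 0.

(* [metric i p] is the Gram matrix of the Riemannian metric at [p] in the
   coordinates of chart [i]. The manifold is connected, which is what makes the
   geodesic distance finite. *)
Record riemannianManifold (R : realType) := RiemannianManifold {
  underlying :> smoothManifold R;
  manifold_connected : connected [set: underlying];
  metric : chart_index underlying -> underlying -> 'M[R]_(dimension underlying);
  metric_sym : forall i p, chart_dom i p -> (metric i p)^T = metric i p;
  metric_pos : forall i p (v : 'rV[R]_(dimension underlying)),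
    chart_dom i p -> v != 0 -> 0 < inner_mx (metric i p) v v;
  metric_compat : forall i j p (v w : 'rV[R]_(dimension underlying)),
    chart_dom i p -> chart_dom j p ->
    let D : 'rV[R]_(dimension underlying) -> 'rV[R]_(dimension underlying) :=
      'd (chart j \o chart_inv i) (chart i p) in
    inner_mx (metric i p) v w = inner_mx (metric j p) (D v) (D w);
  metric_smooth : forall i,
    smooth_on (chart i @` chart_dom i) (metric i \o chart_inv i)
}.

Section GeodesicDistance.
Variables (R : realType) (M : riemannianManifold R).

(* A C^1 curve on [0, 1] is represented by a function on the whole line which
   is C^1 around each point of [0, 1]; its values elsewhere are irrelevant. *)
Definition C1_curve (g : R -> M) : Prop :=
  forall t : R, 0 <= t <= 1 ->
    {for t, continuous g} /\
    forall i : chart_index M, chart_dom i (g t) ->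
      (\forall s \near t, derivable (chart i \o g) s 1) /\
      {for t, continuous (derive1 (chart i \o g))}.

Definition speed (g : R -> M) (t : R) : R :=
  let i := chart_at (g t) in
  let v := derive1 (chart i \o g) t in
  Num.sqrt (inner_mx (metric i (g t)) v v).

Definition curve_length (g : R -> M) : \bar R :=
  (\int[lebesgue_measure]_(t in `[0%R, 1%R]) (speed g t)%:E)%E.

(* A piecewise C^1 curve is a finite list of C^1 curves joined end to end. *)
Fixpoint joins (x : M) (gs : seq (R -> M)) (y : M) : Prop :=
  match gs with
  | [::] => x = y
  | g :: gs' => [/\ C1_curve g, g 0 = x & joins (g 1) gs' y]
  end.

Definition geodesic_dist (x y : M) : R :=
  fine (ereal_inf [set (\sum_(g <- gs) curve_length g)%E
                  | gs in [set gs | joins x gs y]]).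

End GeodesicDistance.

Section Sequences.
Variables (R : realType) (M : riemannianManifold R).

(* Also used for the masks, hence the arbitrary type of values. *)
Definition downsample (T : Type) (c : int -> T) : int -> T := fun k => c (2 * k).

Definition displacement (c : int -> M) : \bar R :=
  ereal_sup (range (fun k : int => (geodesic_dist (c (k + 1)) (c k))%:E)).

Definition seq_dist (c m : int -> M) : \bar R :=
  ereal_sup (range (fun k : int => (geodesic_dist (c k) (m k))%:E)).

End Sequences.

Section Masks.
Variable R : realType.
Implicit Types a g z : int -> R.

Definition support_of a : set int := [set k | a k != 0].

(* All the sums [\sum_(i \in _)] below have finitely many nonzero terms,
   the masks involved being finitely supported. *)
Definition shift_invariant a : Prop :=
  \sum_(i \in [set: int]) a (2 * i) = 1 /\
  \sum_(i \in [set: int]) a (2 * i + 1) = 1.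

Definition linear_subdivision a (f : int -> R) : int -> R :=
  fun k => \sum_(i \in [set: int]) a (k - 2 * i) * f i.

(* Uniform convergence, at the dyadic points, to a continuous function, for
   every bounded initial sequence. *)
Definition convergent_scheme a : Prop :=
  forall f : int -> R, (exists B : R, forall k, `|f k| <= B) ->
  exists2 F : R -> R, continuous F &
    forall e : R, 0 < e -> \forall j \near \oo, forall k : int,
      `|iter j (linear_subdivision a) f k - F (k%:~R / 2 ^+ j)| <= e.

Definition convolution g a : int -> R :=
  fun k => \sum_(i \in [set: int]) g (k - i) * a i.

Definition kronecker : int -> R := fun k => (k == 0)%:R.

(* The sum over the integers of [g] is [1], as the limit of the symmetric
   partial sums; it is applied to absolutely summable sequences only. *)
Definition sum_to_one g : Prop :=
  (fun n : nat => \sum_(0 <= i < (2 * n).+1) g (i%:Z - n%:Z)) @ \oo --> (1 : R).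

Definition geometric_decay g : Prop :=
  exists C lambda : R, [/\ 0 < C, 0 < lambda, lambda < 1 &
    forall k : int, `|g k| <= C * lambda ^+ `|k|%N].

Definition truncation (e : R) g : int -> R :=
  fun k => if e < `|g k| then g k else 0.

Definition truncation_sum (e : R) g : R :=
  \sum_(i \in support_of (truncation e g)) truncation e g i.

Definition normalized_truncation (e : R) g : int -> R :=
  fun k => truncation e g k / truncation_sum e g.

End Masks.

Section Operators.
Variables (R : realType) (M : riemannianManifold R).
Implicit Types (a z : int -> R) (c : int -> M).

Definition is_minimizer (f : M -> R) (x : M) : Prop := forall y, f x <= f y.

(* The default value [x0] is returned only when there is no minimizer. *)
Definition argmin (x0 : M) (f : M -> R) : M := xget x0 [set x | is_minimizer f x].

Definition subdivision_energy a c (k : int) (x : M) : R :=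
  \sum_(i \in [set: int]) a (k - 2 * i) * geodesic_dist x (c i) ^+ 2.

Definition decimation_energy z c (k : int) (x : M) : R :=
  \sum_(i \in [set: int]) z (k - i) * geodesic_dist x (c (2 * i)) ^+ 2.

Definition subdivision a c : int -> M :=
  fun k => argmin (c k) (subdivision_energy a c k).

Definition decimation z c : int -> M :=
  fun k => argmin (c k) (decimation_energy z c k).

Definition subdivision_admissible a c : Prop :=
  forall k, exists! x, is_minimizer (subdivision_energy a c k) x.

Definition decimation_admissible z c : Prop :=
  forall k, exists! x, is_minimizer (decimation_energy z c k) x.

Definition admissible a z c : Prop :=
  subdivision_admissible a c /\ decimation_admissible z c.

(* Quantified over the sequences on which the operator is well defined. *)
Definition interpolating a : Prop :=
  forall c, subdivision_admissible a c -> forall k, subdivision a c (2 * k) = c k.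

(* [A] is the class of sequences on which the operators are considered. *)
Definition displacement_safe (A : set (int -> M))
    (T : (int -> M) -> (int -> M)) : Prop :=
  exists2 E : R, 0 <= E & forall c, A c ->
    (seq_dist c (downsample (T c)) <= E%:E * displacement c)%E.

Definition decimation_safe (A : set (int -> M))
    (Y : (int -> M) -> (int -> M)) : Prop :=
  exists2 F : R, 0 <= F & forall c, A c ->
    (seq_dist (Y c) (downsample c) <= F%:E * displacement c)%E.

Definition safe_pair (A : set (int -> M))
    (T Y : (int -> M) -> (int -> M)) : Prop :=
  displacement_safe A T /\ decimation_safe A Y.

End Operators.

(* Main.v *)
(* If [x] minimizes [y |-> sum_i w_i d(y, q_i)^2] with [sum_i w_i = 1] and all
   the [q_i] with [w_i <> 0] are within [B] of [p], then [d(x, q_i)^2] differs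
   from [d(x, p)^2] by at most [B (2 d(x, p) + B)]; comparing the energies at [x]
   and at [p] bounds [d(x, p)] by a multiple of [B] depending only on [sum |w_i|].
   For a finitely supported mask and a sequence of displacement [D], [B] is a
   multiple of [D]. The argument only uses that [d] is a finite pseudometric:
   a C^1 curve has continuous speed, hence finite length, reversing it preserves
   its length, and by connectedness any two points are joined by chart segments. *)
Require Import Defs.
From mathcomp Require Import all_boot all_order all_algebra.
From mathcomp Require Import all_classical all_reals all_analysis.
From mathcomp Require Import unstable ring lra zify.

Set Implicit Arguments.
Unset Strict Implicit.
Unset Printing Implicit Defensive.

Import Order.TTheory GRing.Theory Num.Theory.
Import numFieldNormedType.Exports.

Local Open Scope classical_set_scope.
Local Open Scope ring_scope.

(** * Speed of a C^1 curve *)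

Section ChartChange.
Variables (R : realType) (M : riemannianManifold R).
Implicit Types (g : R -> M) (t : R).

Lemma near_chart_dom g t (i : chart_index M) :
  {for t, continuous g} -> chart_dom i (g t) ->
  \forall s \near t, chart_dom i (g s).
Proof.
move=> gt ig; apply: gt; apply: open_nbhs_nbhs; split => //.
exact: chart_dom_open.
Qed.

Lemma transition_differentiable (i j : chart_index M) (p : M) :
  chart_dom i p -> chart_dom j p ->
  differentiable (chart j \o chart_inv i) (chart i p).
Proof.
move=> ip jp; have [+ _] := @transition_smooth R M i j 1%N.
by apply; exists p.
Qed.

Lemma derive1_chart_change g t (i j : chart_index M) :
  (\forall s \near t, chart_dom i (g s)) -> chart_dom j (g t) ->
  derivable (chart i \o g) t 1 ->
  derive1 (chart j \o g) t =
    'd (chart j \o chart_inv i) (chart i (g t)) (derive1 (chart i \o g) t).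
Proof.
move=> ig jg dg; have igt := nbhs_singleton ig.
have dgt : differentiable (chart i \o g) t by apply/derivable1_diffP.
have dT := transition_differentiable igt jg.
rewrite derive1E.
(* The two curves agree only near [t], where [chart_inv i] inverts [chart i]; their derivatives at
   [t] depend on nothing else. *)
have -> : 'D_1 (chart j \o g) t =
    'D_1 ((chart j \o chart_inv i) \o (chart i \o g)) t.
  apply: near_eq_derive; near=> s => /=; rewrite chartK//.
  by near: s.
rewrite deriveE; last exact: differentiable_comp.
by rewrite diff_comp//= derive1E'.
Unshelve. all: by end_near. Qed.

(** By [metric_compat] the length of a velocity does not depend on the chart, so [chart_at (g t)]
    can be traded for any chart that contains [g] near [t]. *)
Lemma speed_chart g t (i : chart_index M) :
  (\forall s \near t, chart_dom i (g s)) -> derivable (chart i \o g) t 1 ->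
  speed g t = Num.sqrt (inner_mx (metric i (g t))
    (derive1 (chart i \o g) t) (derive1 (chart i \o g) t)).
Proof.
move=> ig dg; have igt := nbhs_singleton ig.
rewrite /speed (derive1_chart_change ig (chart_atP _) dg).
by rewrite (metric_compat _ _ igt (chart_atP (g t))).
Qed.

(** The form is a polynomial in the entries of its three arguments. All three vary because the Gram
    matrix moves along a curve together with the velocity. *)
Lemma cvg_inner_mx (T : Type) (F : set_system T) (n : nat) (G : T -> 'M[R]_n)
    (v w : T -> 'rV[R]_n) (G0 : 'M[R]_n) (v0 w0 : 'rV[R]_n) :
  Filter F -> G @ F --> G0 -> v @ F --> v0 -> w @ F --> w0 ->
  inner_mx (G x) (v x) (w x) @[x --> F] --> inner_mx G0 v0 w0.
Proof.
move=> FF cG cv cw.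
have ce m1 m2 (H : T -> 'M[R]_(m1, m2)) (H0 : 'M[R]_(m1, m2)) i j :
    H @ F --> H0 -> H x i j @[x --> F] --> H0 i j.
  by move=> cH; apply: (cvg_comp H (fun A => A i j) cH); exact: coord_continuous.
rewrite [X in X @ _](_ : _ =
    fun x => \sum_k (\sum_j v x 0 j * G x j k) * w x 0 k); last first.
  by apply/funext => x; rewrite /inner_mx mxE; apply: eq_bigr => k _; rewrite !mxE.
rewrite [X in _ --> X](_ : _ = \sum_k (\sum_j v0 0 j * G0 j k) * w0 0 k); last first.
  by rewrite /inner_mx mxE; apply: eq_bigr => k _; rewrite !mxE.
apply: cvg_big => [|k _]; first exact: add_continuous.
apply: cvgM; last exact: ce.
apply: cvg_big => [|j _]; first exact: add_continuous.
by apply: cvgM; exact: ce.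
Qed.

(* [speed] reads the velocity in the arbitrary chart [chart_at (g s)], which may
   jump with [s]; near [t] it is computed in the single chart at [g t]. *)
Lemma speed_continuous g t : C1_curve g -> 0 <= t <= 1 ->
  {for t, continuous (speed g)}.
Proof.
move=> gC1 t01; have [gt /(_ _ (chart_atP (g t)))] := gC1 t t01.
set i := chart_at (g t) => -[dg cg].
have ig : \forall s \near t, chart_dom i (g s).
  by apply: near_chart_dom => //; exact: chart_atP.
rewrite /prop_for /continuous_at (speed_chart ig (nbhs_singleton dg)).
have : \forall s \near t, Num.sqrt (inner_mx ((metric i \o chart_inv i) (chart i (g s)))
    (derive1 (chart i \o g) s) (derive1 (chart i \o g) s)) = speed g s.
  (* [speed_chart] at [s] needs the curve to stay in the chart around [s], not only at [s]. *)
  have ig' := near_join ig.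
  near=> s; rewrite (@speed_chart g s i)/=; [|by near: s|by near: s].
  by rewrite chartK//; near: s.
move=> /near_eq_cvg /cvg_trans; apply.
apply: (cvg_comp _ (@Num.sqrt R)); last exact: sqrt_continuous.
apply: cvg_inner_mx => //.
have igt : chart_dom i (g t) := chart_atP (g t).
have -> : metric i (g t) = (metric i \o chart_inv i) (chart i (g t)).
  by rewrite /= chartK.
apply: (cvg_comp (chart i \o g) (metric i \o chart_inv i)).
  exact: (cvg_comp _ _ gt (chart_continuous igt)).
by apply: (@metric_smooth R M i 0%N); exists (g t).
Unshelve. all: by end_near. Qed.

Lemma curve_length_ge0 g : (0 <= curve_length g)%E.
Proof. by apply: integral_ge0 => t _; rewrite lee_fin sqrtr_ge0. Qed.

Lemma speed_within g : C1_curve g -> {within `[0, 1], continuous (speed g)}.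
Proof.
move=> gC1; apply: continuous_in_subspaceT => t; rewrite inE/= in_itv/= => t01.
exact: speed_continuous.
Qed.

Lemma curve_length_fin g : C1_curve g -> curve_length g \is a fin_num.
Proof.
move=> gC1; apply: integrable_fin_num => //.
apply: continuous_compact_integrable; first exact: segment_compact.
exact: speed_within.
Qed.

End ChartChange.

(** * Curve reversal and chart segments *)

Section Reversal.
Variables (R : realType) (M : riemannianManifold R).
Implicit Types (g : R -> M) (t : R).

Lemma near_comp (T U : topologicalType) (f : T -> U) (x : T) (P : set U) :
  {for x, continuous f} -> (\forall y \near f x, P y) ->
  \forall z \near x, P (f z).
Proof. exact. Qed.

Lemma onem_continuous t : {for t, continuous (@onem R)}.
Proof. by apply: continuousB; [exact: cst_continuous|exact: cvg_id]. Qed.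

Lemma derive1_comp_onem (V : normedModType R) (f : R -> V) t :
  derivable f t.~ 1 ->
  derivable (f \o @onem R) t 1 /\ derive1 (f \o @onem R) t = - derive1 f t.~.
Proof.
move=> df.
have dfd : differentiable f t.~ by apply/derivable1_diffP.
have donem : is_derive t (1 : R) (@onem R) (- 1).
  by rewrite -[- 1]add0r; apply: is_deriveB.
have dod : differentiable (@onem R) t.
  by apply/derivable1_diffP; exact: ex_derive.
have dc : differentiable (f \o @onem R) t by exact: differentiable_comp.
split; first by apply/derivable1_diffP.
rewrite (derive1E' dc) diff_comp//= -(deriveE _ dod) derive_val linearN.
by rewrite derive1E'.
Qed.

Definition reverse g : R -> M := g \o @onem R.

Lemma C1_curve_reverse g : C1_curve g -> C1_curve (reverse g).
Proof.
move=> gC1 t t01.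
have [gt dg] : {for t.~, continuous g} /\ forall i, chart_dom i (g t.~) ->
      (\forall s \near t.~, derivable (chart i \o g) s 1) /\
      {for t.~, continuous (derive1 (chart i \o g))}.
  by apply: gC1; rewrite /onem; lra.
have ot := @onem_continuous t.
split=> [|i /dg[{}dg cg]]; first exact: (cvg_comp (@onem R) g ot gt).
have dg' := near_comp ot dg.
split.
  by apply: filterS dg' => s /derive1_comp_onem[].
rewrite /prop_for /continuous_at (derive1_comp_onem (nbhs_singleton dg')).2.
have : \forall s \near t,
    - derive1 (chart i \o g) s.~ = derive1 (chart i \o reverse g) s.
  by apply: filterS dg' => s /derive1_comp_onem[_ ->].
move=> /near_eq_cvg /cvg_trans; apply; apply: cvgN.
exact: (cvg_comp (@onem R) _ ot cg).
Qed.

(** Reversal only changes the sign of the velocity, and the form is even. Both sides read the chart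
    at the same point, so no change of chart occurs. *)
Lemma speed_reverse g t : C1_curve g -> 0 <= t <= 1 ->
  speed (reverse g) t = speed g t.~.
Proof.
move=> gC1 t01; have t01' : 0 <= t.~ <= 1 by rewrite /onem; lra.
have [_ /(_ _ (chart_atP _))[/nbhs_singleton dg _]] := gC1 _ t01'.
rewrite /speed [reverse g t]/= (derive1_comp_onem dg).2.
by rewrite /inner_mx mulNmx linearN/= mulNmx mulmxN opprK.
Qed.

Lemma curve_length_reverse g : C1_curve g ->
  curve_length (reverse g) = curve_length g.
Proof.
move=> gC1.
have r1 : 0 <= (1 : R) <= 1 by rewrite ler01 lexx.
rewrite [RHS](integration_by_substitution_onem r1 (speed_within gC1)) onem1.
by apply: eq_integral => t; rewrite inE/= in_itv/= => t01; rewrite speed_reverse.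
Qed.

Lemma joins_cat (x y z : M) gs gs' :
  joins x gs y -> joins y gs' z -> joins x (gs ++ gs') z.
Proof.
elim: gs x => [|g gs IH] x /=; first by move=> ->.
by move=> [gC1 g0 ggs] ygs'; split=> //; exact: IH.
Qed.

Lemma joins_reverse (x y : M) gs : joins x gs y ->
  exists2 gs', joins y gs' x &
    (\sum_(g <- gs') curve_length g = \sum_(g <- gs) curve_length g)%E.
Proof.
elim: gs x => [|g gs IH] x /=.
  by move=> ->; exists [::].
move=> [gC1 g0 /IH[gs' jgs' len]].
exists (gs' ++ [:: reverse g]).
  apply: joins_cat jgs' _ => /=; rewrite /reverse/= onem0 onem1 g0.
  by split => //; exact: C1_curve_reverse.
rewrite big_cat big_seq1 big_cons (curve_length_reverse gC1) len.
exact: addeC.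
Qed.

Lemma joins_length_fin (x y : M) gs : joins x gs y ->
  (\sum_(g <- gs) curve_length g)%E \is a fin_num.
Proof.
elim: gs x => [|g gs IH] x /=; first by rewrite big_nil.
move=> [gC1 _ /IH]; rewrite big_cons fin_numD => ->.
by rewrite curve_length_fin.
Qed.

End Reversal.

Section ChartSegments.
Variables (R : realType) (M : riemannianManifold R).

Lemma segment_ball (V : normedModType R) (c a b : V) (e t : R) :
  ball c e a -> ball c e b -> 0 <= t <= 1 -> ball c e (a + t *: (b - a)).
Proof.
rewrite -ball_normE/= => ca cb /andP[t0 t1].
have -> : c - (a + t *: (b - a)) = (1 - t) *: (c - a) + t *: (c - b).
  have -> : b - a = (c - a) - (c - b) by rewrite opprB [RHS]addrC addrA subrK.
  rewrite opprD addrA; move: (c - a) (c - b) => u w.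
  by rewrite scalerBr opprB scalerBl scale1r -addrA [- _ + _]addrC.
apply: le_lt_trans (ler_normD _ _) _.
rewrite !normrZ ger0_norm ?subr_ge0// (ger0_norm t0).
move: `|c - a| `|c - b| ca cb => A B Ae Be.
(* Strictness comes from the term [t * (e - B)], which vanishes at [t = 0]; that case is settled
   apart. *)
have [->|tN0] := eqVneq t 0; first by lra.
have tB : 0 < t * (e - B) by rewrite mulr_gt0 ?subr_gt0// lt_neqAle eq_sym tN0.
have tA : 0 <= (1 - t) * (e - A) by rewrite mulr_ge0 ?subr_ge0// ltW.
by nra.
Qed.

(** Read in another chart [j], the curve is a transition map applied to an affine line, with
    derivative ['D_v] of that map; this is continuous because transitions are C^1. Openness of the
    chart image extends the hypothesis to a neighbourhood of each time. *)
Lemma C1_curve_segment (i : chart_index M) (a v : 'rV[R]_(dimension M)) :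
  (forall t, 0 <= t <= 1 -> (chart i @` chart_dom i) (a + t *: v)) ->
  C1_curve (fun t => chart_inv i (a + t *: v)).
Proof.
pose l t := a + t *: v; move=> lU t t01.
have lC s : {for s, continuous l}.
  by apply: cvgD; [exact: cvg_cst|apply: cvgZr_tmp; exact: cvg_id].
have lD s : is_derive s (1 : R) l v.
  have ld : differentiable (fun u : R => u *: v) s by exact: differentiableZl.
  rewrite -[X in is_derive _ _ _ X]add0r; apply: is_deriveD.
  apply: DeriveDef; first exact/derivable1_diffP.
  by rewrite -derive1E derive1E'// diffZl//= -deriveE// derive_id scale1r.
have [q iq ql] := lU t t01.
have gC : {for t, continuous (chart_inv i \o l)}.
  apply: (cvg_comp _ _ (lC t)).
  by have := chart_inv_continuous iq; rewrite /prop_for/continuous_at ql.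
split => // j jg.
have jq : chart_dom j q by move: jg; rewrite -ql chartK.
have Ut : \forall s \near t, (chart i @` chart_dom i) (l s).
  apply: lC; apply: open_nbhs_nbhs; split; last exact: lU.
  exact: chart_image_open.
have jt : \forall s \near t, chart_dom j (chart_inv i (l s)).
  exact: near_chart_dom.
have Dt : \forall s \near t, 
    (chart i @` (chart_dom i `&` chart_dom j)) (l s).
  near=> s; have [p ip pl] : (chart i @` chart_dom i) (l s) by near: s.
  exists p => //; split => //; rewrite -(chartK ip) pl.
  by near: s.
have [TD TC] := @transition_smooth R M i j 1%N.
have ds s : (chart i @` (chart_dom i `&` chart_dom j)) (l s) ->
    derivable (chart j \o (chart_inv i \o l)) s 1 /\
    derive1 (chart j \o (chart_inv i \o l)) s =
      'D_v (chart j \o chart_inv i) (l s).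
  move=> /TD dT.
  have dl : differentiable l s by apply/derivable1_diffP; exact: ex_derive.
  have dc : differentiable ((chart j \o chart_inv i) \o l) s.
    exact: differentiable_comp.
  split; first by apply/derivable1_diffP.
  by rewrite (derive1E' dc) diff_comp//= deriveE// -(deriveE _ dl) derive_val.
split; first by near=> s; apply: (ds _ _).1; near: s.
rewrite /prop_for /continuous_at (ds _ (nbhs_singleton Dt)).2.
have : \forall s \near t, 'D_v (chart j \o chart_inv i) (l s) =
    derive1 (chart j \o (chart_inv i \o l)) s.
  by near=> s; apply/esym/(ds _ _).2; near: s.
move=> /near_eq_cvg /cvg_trans; apply.
apply: (cvg_comp l ('D_v (chart j \o chart_inv i)) (lC t)).
by apply: TC; exact: nbhs_singleton Dt.
Unshelve. all: by end_near. Qed.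

(** Balls in coordinates are convex, so points with coordinates in a small ball are joined by a
    chart segment. Taking the interior makes [W] open at once, leaving only continuity of the chart
    at [p] to use. *)
Lemma near_joined (p : M) : exists2 W : set M, open_nbhs p W &
  forall x y, W x -> W y -> exists gs, joins x gs y.
Proof.
pose i := chart_at p; have ip : chart_dom i p := chart_atP p.
have [e /= e0 eU] : exists2 e : R, 0 < e &
    ball (chart i p) e `<=` chart i @` chart_dom i.
  have : nbhs (chart i p) (chart i @` chart_dom i).
    by apply: open_nbhs_nbhs; split; [exact: chart_image_open|exists p].
  by move=> /nbhs_ballP[e /= e0 eU]; exists e.
exists ((chart i @^-1` ball (chart i p) e `&` chart_dom i)°).
  split; first exact: open_interior.
  apply: filterI.
    by apply: (chart_continuous ip); exact: nbhsx_ballx.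
  by apply: open_nbhs_nbhs; split => //; exact: chart_dom_open.
move=> x y /interior_subset[/= xe ix] /interior_subset[/= ye iy].
exists [:: fun t => chart_inv i (chart i x + t *: (chart i y - chart i x))] => /=.
split; last 2 first.
- by rewrite scale0r addr0 chartK.
- by rewrite scale1r addrC subrK chartK.
by apply: C1_curve_segment => t t01; apply: eU; exact: segment_ball.
Qed.

(* The points joined to [x] form a clopen set. *)
Lemma exists_joins (x y : M) : exists gs, joins x gs y.
Proof.
pose S := [set z | exists gs, joins x gs z].
suff ST : S = [set: M] by have : S y by rewrite ST.
apply: (@manifold_connected R M); first by exists x; exists [::].
  exists S; last by rewrite setTI.
  rewrite openE => z [gs xz].
  have [W Wz WJ] := near_joined z.
  apply: filterS (open_nbhs_nbhs Wz) => w Ww.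
  have [gs' zw] := WJ _ _ (nbhs_singleton (open_nbhs_nbhs Wz)) Ww.
  by exists (gs ++ gs'); exact: joins_cat zw.
exists S; last by rewrite setTI.
(* Closedness: a neighbourhood of a limit point [z] meets the set at some [w], and [w] is joined to
   [z] inside it. *)
move=> z Sz; have [W Wz WJ] := near_joined z.
have [w [[gs xw] Ww]] := Sz _ (open_nbhs_nbhs Wz).
have [gs' wz] := WJ _ _ Ww (nbhs_singleton (open_nbhs_nbhs Wz)).
by exists (gs ++ gs'); exact: joins_cat wz.
Qed.

End ChartSegments.

(** * The geodesic distance is a finite pseudometric *)

Section GeodesicDistanceTheory.
Variables (R : realType) (M : riemannianManifold R).
Implicit Types (x y z : M).

(** [fine] loses nothing: some chain of curves joins the points, its length is finite, and lengths
    are nonnegative. *)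
Lemma geodesic_dist_EFin x y : (geodesic_dist x y)%:E =
  ereal_inf [set (\sum_(g <- gs) curve_length g)%E | gs in [set gs | joins x gs y]].
Proof.
rewrite /geodesic_dist fineK// ge0_fin_numE.
  have [gs xy] := exists_joins x y.
  apply: le_lt_trans (ereal_inf_lbound _) _; first by exists gs.
  by have /fin_numPlt/andP[] := joins_length_fin xy.
apply: le_ereal_inf_tmp => _ [gs _ <-].
by apply: sume_ge0 => g _; exact: curve_length_ge0.
Qed.

Lemma geodesic_dist_le_length x y gs : joins x gs y ->
  ((geodesic_dist x y)%:E <= \sum_(g <- gs) curve_length g)%E.
Proof. by rewrite geodesic_dist_EFin => xy; apply: ereal_inf_lbound; exists gs. Qed.

Lemma geodesic_dist_ge0 x y : 0 <= geodesic_dist x y.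
Proof.
rewrite -lee_fin geodesic_dist_EFin; apply: le_ereal_inf_tmp => _ [gs _ <-].
by apply: sume_ge0 => g _; exact: curve_length_ge0.
Qed.

Lemma geodesic_distxx x : geodesic_dist x x = 0.
Proof.
apply/eqP; rewrite eq_le geodesic_dist_ge0 andbT -lee_fin.
by have := @geodesic_dist_le_length x x [::] erefl; rewrite big_nil.
Qed.

Lemma geodesic_distC x y : geodesic_dist x y = geodesic_dist y x.
Proof.
suff le x' y' : geodesic_dist x' y' <= geodesic_dist y' x'.
  by apply/eqP; rewrite eq_le !le.
rewrite -lee_fin [leRHS]geodesic_dist_EFin; apply: le_ereal_inf_tmp => _ [gs yx <-].
by have [gs' xy <-] := joins_reverse yx; exact: geodesic_dist_le_length.
Qed.

(** The infima need not be attained, so chains within [e / 2] of optimal are concatenated. *)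
Lemma geodesic_dist_triangle y x z :
  geodesic_dist x z <= geodesic_dist x y + geodesic_dist y z.
Proof.
have adh (u v : M) (e : R) : 0 < e -> exists2 gs, joins u gs v &
    (\sum_(g <- gs) curve_length g < (geodesic_dist u v + e)%:E)%E.
  move=> e0; have : (geodesic_dist u v)%:E \is a fin_num by [].
  rewrite geodesic_dist_EFin => /(lb_ereal_inf_adherent e0)[_ [gs uv <-] lt].
  by exists gs => //; rewrite EFinD geodesic_dist_EFin.
apply/ler_addgt0Pr => e e0; have e20 : 0 < e / 2 by rewrite divr_gt0.
have [gs xy lxy] := adh x y _ e20; have [gs' yz lyz] := adh y z _ e20.
rewrite -lee_fin; apply: le_trans (geodesic_dist_le_length (joins_cat xy yz)) _.
rewrite big_cat/=; apply: le_trans (leeD (ltW lxy) (ltW lyz)) _.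
by rewrite -EFinD lee_fin; lra.
Qed.

Lemma geodesic_dist_steps (c : int -> M) (D : R) (k : int) (n : nat) :
  (forall j, geodesic_dist (c (j + 1)) (c j) <= D) ->
  geodesic_dist (c (k + n%:Z)) (c k) <= n%:R * D.
Proof.
move=> cD; elim: n => [|n IH]; first by rewrite addr0 geodesic_distxx mul0r.
apply: le_trans (geodesic_dist_triangle (c (k + n%:Z)) _ _) _.
rewrite -[n.+1]addn1 PoszD addrA natrD mulrDl mul1r [leRHS]addrC.
exact: lerD.
Qed.

Lemma geodesic_dist_absz (c : int -> M) (D : R) (i k : int) :
  (forall j, geodesic_dist (c (j + 1)) (c j) <= D) ->
  geodesic_dist (c i) (c k) <= `|i - k|%:R * D.
Proof.
move=> cD; have [ki|ik] := leP k i.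
  have {1}-> : i = k + `|i - k|%N by lia.
  exact: geodesic_dist_steps.
rewrite geodesic_distC; have {1}-> : k = i + `|i - k|%N by lia.
exact: geodesic_dist_steps.
Qed.

End GeodesicDistanceTheory.

(** * Centers of mass *)

(** One list serves every summand that vanishes where [w] does, so the weights and the energies at
    different points become sums over the same indices. *)
Lemma sum_finite_support (R : realType) (w : int -> R) : finite_set (support_of w) ->
  exists s : seq int, forall f : int -> R, (forall i, w i = 0 -> f i = 0) ->
    \sum_(i \in [set: int]) f i = \sum_(i <- s) f i.
Proof.
move=> /finite_seqP[s sE]; exists (undup s) => f f0.
rewrite (fsbigE (undup s)) ?undup_uniq//.
  by apply: eq_bigl => i; rewrite in_setT.
move=> i _; rewrite mem_undup => /negP si; apply: f0; apply: contrapT => /eqP wi.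
by apply: si; change ([set` s] i); rewrite -sE.
Qed.

Section CenterOfMass.
Variables (R : realType) (M : riemannianManifold R).

(* Since the weights sum to 1, comparing the energies at [x] and [p] gives
   [r^2 <= 2 A B (r + B)], where [r = d(x, p)] and [A] is the l^1 norm of [w]. *)
Lemma center_of_mass_dist_le (I : eqType) (s : seq I) (w : I -> R) (q : I -> M)
    (x p : M) (B : R) :
  \sum_(i <- s) w i = 1 ->
  {in s, forall i, geodesic_dist (q i) p <= B} ->
  \sum_(i <- s) w i * geodesic_dist x (q i) ^+ 2 <=
    \sum_(i <- s) w i * geodesic_dist p (q i) ^+ 2 ->
  0 <= B ->
  geodesic_dist x p <= (2 * \sum_(i <- s) `|w i| + 2) * B.
Proof.
move=> w1 qB xp B0; set A := \sum_(i <- s) `|w i|; set r := geodesic_dist x p.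
have A0 : 0 <= A by apply: sumr_ge0.
have r0 : 0 <= r by exact: geodesic_dist_ge0.
have rE : r ^+ 2 <= A * (2 * B * (r + B)).
  have -> : r ^+ 2 = \sum_(i <- s) w i * (r ^+ 2 - geodesic_dist x (q i) ^+ 2) +
      \sum_(i <- s) w i * geodesic_dist x (q i) ^+ 2.
    rewrite -big_split/= -[LHS]mul1r -w1 big_distrl/=; apply: eq_bigr => i _.
    by rewrite -mulrDr subrK.
  apply: le_trans (lerD (lexx _) xp) _.
  rewrite -big_split/= /A big_distrl/= big_seq [leRHS]big_seq.
  apply: ler_sum => i si; rewrite -mulrDr; apply: le_trans (ler_norm _) _.
  rewrite normrM ler_wpM2l//.
  have := qB i si; have := geodesic_dist_ge0 (q i) p.
  have := geodesic_dist_triangle (q i) x p; have := geodesic_dist_triangle p x (q i).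
  rewrite -/r (geodesic_distC p (q i)).
  have := geodesic_dist_ge0 x (q i).
  move: (geodesic_dist x (q i)) (geodesic_dist (q i) p) => u d.
  move=> u0 h1 h2 d0 dB.
  (* Here [|u - r| <= d <= B], so [|r^2 - u^2| <= d (2 r + d)]; adding [d^2] gives at most
     [2 B (r + B)]. *)
  by rewrite ler_norml; apply/andP; split; nra.
(* If [r > (2 A + 2) B], then [r - 2 A B > 2 B], so [(r - 2 A B) r > 2 B r >= 4 (A + 1) B^2],
   against the quadratic bound. *)
rewrite leNgt; apply/negP => rB.
have : (r - 2 * A * B) * r <= 2 * A * B ^+ 2 by nra.
apply/negP; rewrite -ltNge.
have AB0 : 0 <= A * B by exact: mulr_ge0.
have ABB0 : 0 <= A * B * B by exact: mulr_ge0.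
have r0' : 0 < r by nra.
have h1 : 2 * B < r - 2 * A * B by nra.
have h2 : 2 * B * r < (r - 2 * A * B) * r by rewrite ltr_pM2r.
have h3 : 2 * B * ((2 * A + 2) * B) <= 2 * B * r.
  by rewrite ler_wpM2l ?mulr_ge0// ltW.
nra.
Qed.

(** Common form of both halves of safety: even entries of the subdivision use the downsampled mask
    on [c], and decimation uses its mask on the downsampled sequence. *)
Lemma minimizer_dist_le (w : int -> R) :
  finite_set (support_of w) -> \sum_(i \in [set: int]) w i = 1 ->
  exists2 E : R, 0 < E & forall (c : int -> M) (D : R) (k : int) (x : M),
    (forall j, geodesic_dist (c (j + 1)) (c j) <= D) ->
    is_minimizer
      (fun y => \sum_(i \in [set: int]) w (k - i) * geodesic_dist y (c i) ^+ 2) x ->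
    geodesic_dist x (c k) <= E * D.
Proof.
move=> /sum_finite_support[s sE] w1.
(* The successor keeps the constant positive even when the mask is supported at [0] alone. *)
pose N := (\max_(i <- s) `|i|%N).+1.
pose A := \sum_(i <- s) `|w i|.
(* Reflecting the index moves the dependence on [k] from the weights to the points, so that [s]
   works for every [k]. *)
have kE (f : int -> R) k : \sum_(i \in [set: int]) f i = \sum_(i \in [set: int]) f (k - i).
  by apply: reindex_fsbigT; exists (fun i => k - i) => i; rewrite subKr.
exists ((2 * A + 2) * N%:R).
  by rewrite mulr_gt0// ltr_wpDl// mulr_ge0// sumr_ge0.
move=> c D k x cD xmin.
have D0 : 0 <= D by apply: le_trans (cD 0); exact: geodesic_dist_ge0.
rewrite -mulrA; apply: (@center_of_mass_dist_le _ s w (fun i => c (k - i))).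
- by rewrite -sE.
- move=> i si; apply: le_trans (geodesic_dist_absz _ _ cD) _.
  rewrite ler_wpM2r// ler_nat.
  have -> : absz (k - i - k)%R = absz i by lia.
  by apply: leqW; exact: (@leq_bigmax_seq _ s xpredT (fun i => absz i)).
- have := xmin (c k); rewrite [leLHS](kE _ k) [leRHS](kE _ k).
  under eq_fsbigr do rewrite subKr; under [X in _ <= X]eq_fsbigr do rewrite subKr.
  by rewrite !sE// => i ->; rewrite mul0r.
- exact: mulr_ge0.
Qed.

(** Only finite displacements need an estimate: if the displacement is infinite, so is the
    right-hand side. This takes [E] nonzero, as zero times infinity is zero. *)
Lemma seq_dist_le (c c' m : int -> M) (E : R) : 0 < E ->
  (forall D, (forall j, geodesic_dist (c (j + 1)) (c j) <= D) ->
    forall k, geodesic_dist (c' k) (m k) <= E * D) ->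
  (seq_dist c' m <= E%:E * displacement c)%E.
Proof.
move=> E0 cE; have cle j : ((geodesic_dist (c (j + 1)) (c j))%:E <= displacement c)%E.
  by apply: ereal_sup_ubound; exists j.
have d0 : (0 <= displacement c)%E.
  by apply: le_trans (cle 0); rewrite lee_fin geodesic_dist_ge0.
apply: ge_ereal_sup => _ [k _ <-].
case dE : (displacement c) d0 cle => [D| |]//= d0 cle.
  by rewrite -EFinM lee_fin; apply: cE => j; rewrite -lee_fin.
by rewrite gt0_muley ?leey// lte_fin.
Qed.

End CenterOfMass.

(** * Masks *)

Section Masks.
Variable R : realType.
Implicit Types a g : int -> R.

Lemma finite_support_downsample a :
  finite_set (support_of a) -> finite_set (support_of (downsample a)).
Proof.
move=> /(finite_image (fun i => (i %/ 2)%Z)); apply: sub_finite_set => i ai.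
by exists (2 * i) => //; lia.
Qed.

Lemma finite_support_truncation e g : 0 < e -> geometric_decay g ->
  finite_set (support_of (truncation e g)).
Proof.
move=> e0 [C [lam [C0 l0 l1 gle]]].
have : \forall n \near \oo, C * lam ^+ n < e.
  have : geometric C lam @ \oo --> (0 : R) by apply: cvg_geometric; rewrite gtr0_norm.
  by move=> /cvgr_lt; apply.
move=> [N _ HN].
(* From rank [N] on the geometric bound is below [e], so the support lies between [-N] and
   [N - 1]. *)
apply: (@sub_finite_set _ _ ((fun i : nat => i%:Z - N%:Z) @` `I_(2 * N)%N)); last first.
  exact/finite_image/finite_II.
move=> k; rewrite /support_of/truncation/=.
case: ifPn => [ek _|]; last by rewrite eqxx.
have kN : (`|k| < N)%N.
  rewrite ltnNge; apply/negP => Nk.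
  have := lt_trans (le_lt_trans (gle k) (HN _ Nk)) ek.
  by rewrite ltxx.
by exists (absz (k + N%:Z)%R); rewrite /=; lia.
Qed.

Lemma finite_support_normalized e g : 0 < e -> geometric_decay g ->
  finite_set (support_of (normalized_truncation e g)).
Proof.
move=> e0 /(finite_support_truncation e0); apply: sub_finite_set => i.
by rewrite /support_of/= /normalized_truncation mulf_eq0 => /norP[].
Qed.

Lemma sum_normalized_truncation e g : 0 < e -> geometric_decay g ->
  truncation_sum e g != 0 ->
  \sum_(i \in [set: int]) normalized_truncation e g i = 1.
Proof.
move=> e0 gd S0.
have /sum_finite_support[s sE] := finite_support_truncation e0 gd.
rewrite sE => [|i ti]; last by rewrite /normalized_truncation ti mul0r.
rewrite -mulr_suml -sE// /truncation_sum.
rewrite -(fsbig_widen (support_of (truncation e g)) setT)//; first by rewrite divff.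
by move=> i [_ /negP]; rewrite negbK => /eqP.
Qed.

End Masks.

Theorem proposition5p2 (R : realType) (M : riemannianManifold R)
    (alpha gamma : int -> R) (epsilon : R)
    (alpha_finite : finite_set (support_of alpha))
    (alpha_shift_invariant : shift_invariant alpha)
    (alpha_convergent : convergent_scheme alpha)
    (alpha_non_interpolating : ~ @interpolating R M alpha)
    (gamma_conv : convolution gamma (downsample alpha) = @kronecker R)
    (gamma_sum : sum_to_one gamma)
    (gamma_decay : geometric_decay gamma)
    (epsilon_gt0 : 0 < epsilon)
    (truncation_neq0 : truncation_sum epsilon gamma != 0) :
  let zeta := normalized_truncation epsilon gamma in
  @safe_pair R M [set c | admissible alpha zeta c]
    (subdivision alpha) (decimation zeta).
Proof.
move=> zeta.
have argminP (f : M -> R) x0 : (exists! x, is_minimizer f x) ->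
    is_minimizer f (argmin x0 f).
  by move=> [x [xf _]]; apply: (@xgetPex _ x0 [set x | is_minimizer f x]); exists x.
split.
(* Since [2 k - 2 i = 2 (k - i)], the even entries only see the even part of the mask, whose sum is
   1 by the first half of shift invariance. *)
- have [E E0 HE] := minimizer_dist_le M (finite_support_downsample alpha_finite)
    alpha_shift_invariant.1.
  exists E; first exact: ltW.
  move=> c [adm _]; apply: seq_dist_le => // D cD k.
  rewrite geodesic_distC; apply: HE cD _.
  have energyE : subdivision_energy alpha c (2 * k) = fun y =>
      \sum_(i \in [set: int]) downsample alpha (k - i) * geodesic_dist y (c i) ^+ 2.
    by apply/funext => y; apply: eq_fsbigr => i _; rewrite /downsample mulrBr.
  by rewrite -energyE; exact: (argminP _ (c (2 * k)) (adm (2 * k))).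
- have [F F0 HF] := minimizer_dist_le M
    (finite_support_normalized epsilon_gt0 gamma_decay)
    (sum_normalized_truncation epsilon_gt0 gamma_decay truncation_neq0).
  (* Neighbours in the downsampled sequence are two steps apart in [c], which doubles the
     displacement. *)
  exists (F * 2); first by rewrite mulr_ge0// ltW.
  move=> c [_ adm]; apply: seq_dist_le => [|D cD k]; first by rewrite mulr_gt0.
  rewrite -mulrA; apply: (HF (downsample c)); last exact: (argminP _ (c k) (adm k)).
  move=> j; apply: le_trans (geodesic_dist_absz _ _ cD) _.
  by have -> : absz (2 * (j + 1) - 2 * j)%R = 2%N by lia.
Qed.
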